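(* The following two assertions are equivalent, i.e. (I) is true if and only if (II) is true. (I) There is an increasing integer function $g$ such that, if $A$ is a finite group with subgroups $U$ and $G$ such that $P_A(U)=P_A(G)$ and $|A:G|=n$, then $|A:U|<g(n)$. (II) There is an increasing integer function $f$ such that, if $A$ is a finite group with normal subgroup $G$ of index $|A:G|=n$, and if $U\leqslant G$ is such that $P_A(U)=P_A(G)$, then $|G:U|<f(n)$.
   Context: For a finite group $A$, an element $x\in A$ and $a\in A$, $x^a=a^{-1}xa$. For a subgroup $U$ of $A$, let $\mathcal{P}(U)=\{x\in U : |x| \text{ is a prime power}\}$ (the identity counts as having prime power order $p^0$), and let $P_A(U)=\{x^a : x\in \mathcal{P}(U),\ a\in A\}$, the union of the $A$-conjugacy classes of elements of prime power order that meet $U$. An increasing integer function is an increasing function from the positive integers to the positive integers. *)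

(* Defs.v *)
From mathcomp Require Import all_boot all_fingroup all_solvable.

Set Implicit Arguments.
Unset Strict Implicit.
Unset Printing Implicit Defensive.

(* Functions from the positive integers to the positive integers are
   represented by functions nat -> nat; the value at 0 is irrelevant. *)
Definition increasing_integer_function (f : nat -> nat) : Prop :=
  (forall n, 0 < n -> 0 < f n) /\ (forall m n, 0 < m -> m < n -> f m < f n).

Section PrimePowerElements.

Variable gT : finGroupType.
Implicit Types (x : gT) (A U : {set gT}).

Definition prime_power_elt x : bool := p_group <[x]>%g.

Lemma prime_power_eltP x :
  reflect (exists p k, prime p /\ #[x]%g = p ^ k) (prime_power_elt x).
Proof.
apply: (iffP idP) => [/p_groupP[p p_pr /p_natP[k ok]]|[p [k [p_pr ok]]]].
  by exists p, k.
by apply: (@pgroup_p _ p); rewrite /pgroup -orderE ok pnatX pnat_id.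
Qed.

Definition prime_power_elts U : {set gT} := [set x in U | prime_power_elt x].

(* class_support B A is {x ^ a | x \in B, a \in A}. *)
Definition prime_power_classes A U : {set gT} :=
  class_support (prime_power_elts U) A.

End PrimePowerElements.

(* Main.v *)
Require Import Defs.
From mathcomp Require Import all_boot all_fingroup all_solvable.

(** (I) implies (II) because |G : U| <= |A : U| when U <= G <= A, so the same
    function serves.

    For the converse, let n = |A : G| and replace G by its normal core K in A. Membership in a
    normal subgroup is invariant under A-conjugation, so intersecting with K
    commutes with forming A-classes of prime power elements
    ([prime_power_classes_setI_normal]); hence U :&: K and K = G :&: K have the
    same prime power classes, and (II) applies to the pair U :&: K <= K in A.
    The action of A on the cosets of G has kernel K, so m := |A : K| is at most
    n! ([index_gcore_leq_fact]), and
      |A : U| <= |A : U :&: K| = m * |K : U :&: K| < m * f m <= n! * f n!.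
    Thus g n := n! * f n! is a suitable bound. *)

Set Implicit Arguments.
Unset Strict Implicit.
Unset Printing Implicit Defensive.

Import GroupScope.

(** The action on the right cosets of [G] embeds [A / gcore G A] in the
    symmetric group on these cosets. *)
Lemma index_gcore_leq_fact (gT : finGroupType) (A G : {group gT}) :
  #|A : gcore G A| <= #|A : G|`!.
Proof.
have nRA : actby_cond A (rcosets G A) ('Rs)%act := actsRs_rcosets G A.
have := card_morphim (actperm_morphism <[nRA]>) A.
rewrite ker_actperm astab_actby !setIT astabRs_rcosets !setIid indexgI => <-.
rewrite -[#|A : G|`!](perm.card_Sym (rcosets G A)) subset_leq_card //.
apply/subsetP=> _ /morphimP[a _ _ ->]; rewrite inE.
apply/subsetP=> X; apply: contraR => notRX.
by rewrite permE /= /actby (negPf notRX).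
Qed.

(** As [K] is normal in [A], an element with an [A]-conjugate in [K] lies in
    [K] itself. *)
Lemma prime_power_classes_setI_normal (gT : finGroupType) (A K : {group gT})
    (U : {set gT}) :
  K <| A ->
  prime_power_classes A (U :&: K) = prime_power_classes A U :&: K.
Proof.
case/andP=> _ nKA; apply/setP=> y; apply/imset2P/setIP.
  case=> x a; rewrite !inE => /andP[/andP[Ux Kx] ppx] Aa ->; split.
    by apply: memJ_class_support; rewrite // inE Ux.
  by rewrite memJ_norm ?(subsetP nKA).
case=> /imset2P[x a /setIdP[Ux ppx] Aa ->].
rewrite memJ_norm ?(subsetP nKA) // => Kx.
by exists x a; rewrite // !inE Ux Kx.
Qed.

Lemma increasing_integer_function_leq (f : nat -> nat) m n :
  increasing_integer_function f -> 0 < m -> m <= n -> f m <= f n.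
Proof.
case=> _ f_incr m_gt0; rewrite leq_eqVlt => /predU1P[-> // | lt_mn].
exact/ltnW/f_incr.
Qed.

Lemma increasing_integer_function_fact (f : nat -> nat) :
  increasing_integer_function f ->
  increasing_integer_function (fun n => n`! * f n`!)%N.
Proof.
case=> f_gt0 f_incr; split=> [n _ | m n m_gt0 lt_mn].
  by rewrite muln_gt0 fact_gt0 f_gt0 ?fact_gt0.
have lt_fact : m`! < n`!.
  (* The factorial takes the same value at 0 and 1, so [0 < m] matters. *)
  case: n lt_mn => // n; rewrite ltnS factS => le_mn.
  apply: leq_ltn_trans (leq_fact le_mn) _.
  by rewrite ltn_Pmull ?fact_gt0 // ltnS (leq_trans m_gt0).
by rewrite ltn_mul // f_incr ?fact_gt0.
Qed.

Theorem theorem1p4 :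
  (exists g : nat -> nat, increasing_integer_function g /\
     forall (gT : finGroupType) (A U G : {group gT}) (n : nat),
       U \subset A -> G \subset A ->
       prime_power_classes A U = prime_power_classes A G ->
       #|A : G|%g = n -> #|A : U|%g < g n)
  <->
  (exists f : nat -> nat, increasing_integer_function f /\
     forall (gT : finGroupType) (A U G : {group gT}) (n : nat),
       (G <| A)%g -> #|A : G|%g = n ->
       U \subset G ->
       prime_power_classes A U = prime_power_classes A G ->
       #|G : U|%g < f n).
Proof.
split=> [[g [g_incr boundA]] | [f [f_incr boundG]]].
  exists g; split=> // gT A U G n /andP[sGA _] iAG sUG eqP.
  apply: leq_ltn_trans (boundA gT A U G n (subset_trans sUG sGA) sGA eqP iAG).
  by rewrite dvdn_leq ?indexSg.
exists (fun n => n`! * f n`!)%N.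
split=> [|gT A U G n sUA sGA eqP iAG]; first exact: increasing_integer_function_fact.
pose K := gcore_group G A.
have nsKA : K <| A := gcore_normal sGA.
have sKG : K \subset G := gcore_sub G A.
have le_m : #|A : K| <= n`! by rewrite -iAG index_gcore_leq_fact.
have eqPK : prime_power_classes A (U :&: K) = prime_power_classes A K.
  rewrite prime_power_classes_setI_normal // eqP.
  by rewrite -prime_power_classes_setI_normal // (setIidPr sKG).
have lt_f := boundG gT A (U :&: K)%G K _ nsKA erefl (subsetIr U K) eqPK.
have le_f := increasing_integer_function_leq f_incr (indexg_gt0 A K) le_m.
apply: leq_ltn_trans (dvdn_leq _ (indexgS A (subsetIl U K))) _ => //.
rewrite -(Lagrange_index (normal_sub nsKA) (subsetIr U K)).
apply: (@leq_trans (#|A : K| * f #|A : K|)%N); last exact: leq_mul.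
by rewrite ltn_pmul2l.
Qed.
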